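(* For all integers $n\ge 1$ and $0\le f<n/3$ and every value set $V$, there is an unauthenticated deterministic algorithm on $n$ processors that solves Graded Byzantine Agreement over $V$ in the presence of at most $f$ Byzantine processors, and that takes two rounds of communication.
   Context: Model. There is a set of $n$ processors with unique known IDs in $\{1,\dots,n\}$, connected as a clique; $n$ and $f$ are known to all. Computation proceeds in synchronous rounds; in each round every processor sends some (or no) messages, then every message sent in the round is received by its destination (which knows the identity of the sender), then every processor performs local computation. Byzantine faults. A worst-case adversary may make up to $f$ processors Byzantine, at any time; it then controls everything they do, including which messages they send or drop and the content of those messages. The other processors are honest and follow the algorithm. An algorithm is unauthenticated if it does not assume or use digital signatures. Graded Byzantine Agreement (GBA). Every processor $p$ has an input value in $V$ and must return a pair $(v,g)$ with $v\in V$ and grade $g\in\{0,1\}$ such that: (Consistency) if an honest processor outputs $(v,1)$, then every honest processor outputs $(v,g)$ for some $g\in\{0,1\}$; (Validity) if all honest processors have the same input $v$, then every honest processor outputs $(v,1)$; (Termination) every honest processor outputs a value after a finite number of rounds. *)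

(* Defs.v *)
From mathcomp Require Import all_boot.

Set Implicit Arguments.
Unset Strict Implicit.
Unset Printing Implicit Defensive.

(* Deterministic synchronous algorithms on n processors, with inputs in I and
   outputs in O. Processors are identified with 'I_n. A local computation
   yields [inl s] (go on from state s) or [inr o] (return o and halt).

   [send p s q] is what p sends to q in a round begun in state s, [None] being
   no message; several messages on one link count as one compound message.
   [compute p s m] is the local computation that ends the round, [m q] being
   what p received from q: the sender is known to the receiver. *)
Record algorithm (n : nat) (I O : Type) := Algorithm {
  state : Type;
  message : Type;
  init : 'I_n -> I -> state + O;
  send : 'I_n -> state -> 'I_n -> option message;
  compute : 'I_n -> state -> ('I_n -> option message) -> state + O
}.

Section Executions.

Variables (n : nat) (I O : Type) (A : algorithm n I O).

Definition sends (p : 'I_n) (x : state A + O) (q : 'I_n) : option (message A) :=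
  if x is inl s then send p s q else None.

Definition step (p : 'I_n) (x : state A + O) (m : 'I_n -> option (message A)) :
    state A + O :=
  if x is inl s then compute p s m else x.

Definition returned (x : state A + O) : bool := if x is inr _ then true else false.

(* Executions with at most f Byzantine processors. Time t is the end of round
   t, and the round between times t and t.+1 is round t.+1.

   [byz t] is the set of processors made Byzantine before the messages of round
   t.+1 are sent, and [msg t p q] is what p sends to q in round t.+1. A
   processor follows A as long as it is not Byzantine; from then on its messages
   are arbitrary elements of [option (message A)] (no signature restricts them)
   and its status carries no information. Quantifying over all executions covers
   adaptive corruption and choices made with full knowledge of the run,
   including the honest messages of the current round. *)
Record execution (f : nat) (input : 'I_n -> I) := Execution {
  byz : nat -> {set 'I_n};
  msg : nat -> 'I_n -> 'I_n -> option (message A);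
  status : nat -> 'I_n -> state A + O;
  byz_mono : forall t, byz t \subset byz t.+1;
  byz_card : forall t, #|byz t| <= f;
  status0 : forall p, p \notin byz 0 -> status 0 p = init A p (input p);
  msg_honest : forall t p q, p \notin byz t ->
    msg t p q = sends p (status t p) q;
  status_honest : forall t p, p \notin byz t.+1 ->
    status t.+1 p = step p (status t p) (fun q => msg t q p)
}.

Definition honest f input (e : execution f input) (p : 'I_n) : Prop :=
  forall t, p \notin byz e t.

(* For honest p the output is unique, since [step] preserves [inr]. *)
Definition outputs f input (e : execution f input) (p : 'I_n) (o : O) : Prop :=
  exists t, status e t p = inr o.

(* In every execution with at most f Byzantine processors, each honest processor
   returns at the end of round R, and not before. *)
Definition takes_rounds (f R : nat) : Prop :=
  forall input (e : execution f input) p, honest e p ->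
    forall t, returned (status e t p) = (R <= t).

End Executions.

(* Outputs are pairs of a value and a grade, [true] being grade 1. *)
Record solves_GBA (n f : nat) (V : Type) (A : algorithm n V (V * bool)) : Prop := {
  GBA_consistency : forall input (e : execution A f input) p v,
    honest e p -> outputs e p (v, true) ->
    forall q, honest e q -> exists g, outputs e q (v, g);
  GBA_validity : forall input (e : execution A f input) v,
    (forall p, honest e p -> input p = v) ->
    forall p, honest e p -> outputs e p (v, true);
  GBA_termination : forall input (e : execution A f input) p,
    honest e p -> exists o, outputs e p o
}.

(* Main.v *)
Require Import Defs.
From mathcomp Require Import all_boot.
From mathcomp Require Import boolp.
From mathcomp Require Import zify.

Set Implicit Arguments.
Unset Strict Implicit.
Unset Printing Implicit Defensive.

(** In round 1 everybody sends its input; in round 2 a processor sends the value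
    it received [n - f] times, if any. Two quorums of size [n - f] share at least
    [n - 2 f > f] processors, hence an honest one, so all honest processors that
    send a value in round 2 send the same one. A value received [f + 1] times in
    round 2 was sent by an honest processor, so it is that common value; it is
    returned, with grade 1 if it was received [n - f] times. In that case every
    honest processor received it at least [n - 2 f >= f + 1] times. *)

Section Quorums.

Variables (n : nat) (V : eqType).
Implicit Types (m : 'I_n -> option V) (v w : V).

Definition support m v : {set 'I_n} := [set q | m q == Some v].

(** [V] may be infinite, so the search runs over senders instead of values. If several values reach
    the threshold, an arbitrary one is picked. *)
Definition quorum (k : nat) m : option V :=
  if [pick q | (m q != None) && (k <= #|[set r | m r == m q]|)] is Some q
  then m q else None.

Lemma quorum_support k m v : quorum k m = Some v -> k <= #|support m v|.
Proof.
rewrite /quorum; case: pickP => // q /andP[_ le_k mq].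
by rewrite mq in le_k.
Qed.

Lemma quorum_exists k m v :
  0 < k -> k <= #|support m v| -> exists w, quorum k m = Some w.
Proof.
move=> k_gt0 le_k; rewrite /quorum; case: pickP => [q /andP[]|noq].
  by case: (m q) => // w _ _; exists w.
have /card_gt0P[q] := leq_trans k_gt0 le_k.
by rewrite inE => /eqP mq; move: (noq q); rewrite mq /= le_k.
Qed.

Lemma card_gt_notin (f : nat) (B S : {set 'I_n}) :
  #|B| <= f -> f < #|S| -> exists2 p, p \in S & p \notin B.
Proof.
move=> leB ltS; apply/subsetPn; apply: contraL ltS => /subset_leq_card leSB.
by rewrite -leqNgt (leq_trans leSB).
Qed.

Lemma card_compl_subset (f : nat) (B S : {set 'I_n}) :
  #|B| <= f -> (forall p, p \notin B -> p \in S) -> n - f <= #|S|.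
Proof.
move=> leB sBS; have /subset_leq_card : ~: B \subset S.
  by apply/subsetP => p; rewrite inE => /sBS.
by have := cardsC B; rewrite card_ord; lia.
Qed.

Lemma card_quorumI (f : nat) (S T : {set 'I_n}) :
  3 * f < n -> n - f <= #|S| -> n - f <= #|T| -> f < #|S :&: T|.
Proof.
move=> hf leS leT; have := cardsUI S T.
by have := max_card (S :|: T); rewrite card_ord; lia.
Qed.

End Quorums.

Section Byzantine.

Variables (n f : nat) (I O : Type) (A : algorithm n I O) (input : 'I_n -> I).
Variable e : execution A f input.

Lemma byz_le t u : t <= u -> byz e t \subset byz e u.
Proof.
move=> /subnK <-; elim: (u - t) => // k IHk.
by rewrite addSn (subset_trans IHk) ?byz_mono.
Qed.

(** Corruption is adaptive, while [honest] speaks of all times. Each processor gets a time by which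
    it is corrupted if it ever is (0 otherwise). There are finitely many processors, so these times
    have a maximum, and [byz] is monotone. *)
Lemma byz_stable : exists t, forall p, p \notin byz e t -> honest e p.
Proof.
have /choice[T T_byz] p : exists t, p \notin byz e t -> honest e p.
  case: (pselect (honest e p)) => [hp|/existsNP[t /negP]]; first by exists 0.
  by rewrite negbK => pt; exists t; rewrite pt.
exists (\max_p T p) => p p_max; apply: T_byz; apply: contra p_max.
exact/subsetP/byz_le/leq_bigmax.
Qed.

(** Turns the bound at each time into a single bound for the whole run, the form in which every
    counting argument below uses it. *)
Lemma byz_bound : exists2 B : {set 'I_n},
  #|B| <= f & forall p, p \notin B -> honest e p.
Proof. by have [t Ht] := byz_stable; exists (byz e t); rewrite ?byz_card. Qed.

End Byzantine.

Section GradedAgreement.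

Variables (n f : nat) (V : eqType).
Hypothesis hf : 3 * f < n.

(* [inl v] is the initial state with input [v]; [inr (v, s)] is the state after
   round 1, [s] being the value to send in round 2. *)
Definition gba_state : Type := V + V * option V.

Definition gba_send (x : gba_state) : option V :=
  match x with inl v => Some v | inr (_, s) => s end.

(** The input [v] is the fallback, with grade 0, when no value is received more than [f] times. *)
Definition gba_return (v : V) (m : 'I_n -> option V) : V * bool :=
  if quorum f.+1 m is Some w then (w, n - f <= #|support m w|) else (v, false).

Definition gba_compute (x : gba_state) (m : 'I_n -> option V) :
    gba_state + V * bool :=
  match x with
  | inl v => inl (inr (v, quorum (n - f) m))
  | inr (v, _) => inr (gba_return v m)
  end.

Definition gba : algorithm n V (V * bool) :=
  @Algorithm n V (V * bool) gba_state V (fun _ v => inl (inl v))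
    (fun _ x _ => gba_send x) (fun _ => gba_compute).

Section Run.

Variables (input : 'I_n -> V) (e : execution gba f input).
Implicit Types (p q : 'I_n) (v w : V).

Definition received t p q : option V := msg e t q p.

Definition round2_value p : option V := quorum (n - f) (received 0 p).

Lemma gba_status0 p : honest e p -> status e 0 p = inl (inl (input p)).
Proof. by move=> hp; rewrite status0. Qed.

Lemma gba_status1 p :
  honest e p -> status e 1 p = inl (inr (input p, round2_value p)).
Proof. by move=> hp; rewrite status_honest // gba_status0. Qed.

Lemma gba_statusSS p t :
  honest e p -> status e t.+2 p = inr (gba_return (input p) (received 1 p)).
Proof.
move=> hp; elim: t => [|t IHt]; rewrite status_honest ?IHt //.
by rewrite gba_status1.
Qed.

Lemma gba_outputs p o : honest e p ->
  outputs e p o <-> gba_return (input p) (received 1 p) = o.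
Proof.
move=> hp; split=> [[[|[|t]]]|<-]; last by exists 2; rewrite gba_statusSS.
- by rewrite gba_status0.
- by rewrite gba_status1.
- by rewrite gba_statusSS // => -[].
Qed.

Lemma received0 p q : honest e q -> received 0 p q = Some (input q).
Proof. by move=> hq; rewrite /received msg_honest // gba_status0. Qed.

Lemma received1 p q : honest e q -> received 1 p q = round2_value q.
Proof. by move=> hq; rewrite /received msg_honest // gba_status1. Qed.

Lemma round2_value_unique p q v w : honest e p -> honest e q ->
  round2_value p = Some v -> round2_value q = Some w -> v = w.
Proof.
move=> hp hq /quorum_support lev /quorum_support lew.
have [B leB honB] := byz_bound e.
have [r] := card_gt_notin leB (card_quorumI hf lev lew).
(* The honest [r] sent its one input to both [p] and [q]. *)
rewrite !inE => /andP[/eqP rv /eqP rw] /honB hr.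
by move: rv rw; rewrite !received0 // => -[<-] [<-].
Qed.

Lemma support_round2_value p v : f < #|support (received 1 p) v| ->
  exists2 q, honest e q & round2_value q = Some v.
Proof.
have [B leB honB] := byz_bound e; move=> /(card_gt_notin leB)[q].
by rewrite inE => /eqP qv /honB hq; exists q; rewrite // -(received1 p hq).
Qed.

Lemma gba_return_grade1 p v u :
  gba_return u (received 1 p) = (v, true) ->
  n - f <= #|support (received 1 p) v|.
Proof. by rewrite /gba_return; case: quorum => // w [-> ->]. Qed.

Lemma support_transfer p q v : n - f <= #|support (received 1 p) v| ->
  f < #|support (received 1 q) v|.
Proof.
have [B leB honB] := byz_bound e => lev.
(* The complement of [B] has at least [n - f] elements, so it acts as the second quorum. The common
   senders are honest and send [q] what they send [p]. *)
have lt_f : f < #|~: B :&: support (received 1 p) v|.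
  by apply: (card_quorumI hf) => //; have := cardsC B; rewrite card_ord; lia.
apply: leq_trans lt_f (subset_leq_card _); apply/subsetP => r.
by rewrite !inE => /andP[/honB hr]; rewrite !received1.
Qed.

(** The value [w] picked by [quorum] might differ from [v]; but each of them has an honest round 2
    sender, and these senders agree. *)
Lemma gba_return_support q v u : f < #|support (received 1 q) v| ->
  gba_return u (received 1 q) = (v, n - f <= #|support (received 1 q) v|).
Proof.
move=> lev; have [w qw] := quorum_exists (ltn0Sn f) lev.
rewrite /gba_return qw.
have [r hr rv] := support_round2_value lev.
have [s hs sw] := support_round2_value (quorum_support qw).
by rewrite (round2_value_unique hr hs rv sw).
Qed.

Lemma round2_value_valid p v : (forall q, honest e q -> input q = v) ->
  honest e p -> round2_value p = Some v.
Proof.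
move=> inv hp; have [B leB honB] := byz_bound e.
have lev : n - f <= #|support (received 0 p) v|.
  apply: (card_compl_subset leB) => q /honB hq.
  by rewrite inE received0 // inv.
have n_f_gt0 : 0 < n - f by lia.
have [w pw] := quorum_exists n_f_gt0 lev.
(* The supports of [v] and [w] at [p] meet in [r], whose one message equals both values. *)
have [r] := card_gt_notin leB (card_quorumI hf lev (quorum_support pw)).
rewrite !inE => /andP[/eqP rv /eqP rw] _.
by rewrite /round2_value pw -rw rv.
Qed.

Lemma gba_return_valid p v u : (forall q, honest e q -> input q = v) ->
  gba_return u (received 1 p) = (v, true).
Proof.
move=> inv; have [B leB honB] := byz_bound e.
have lev : n - f <= #|support (received 1 p) v|.
  apply: (card_compl_subset leB) => q /honB hq.
  by rewrite inE received1 // (round2_value_valid inv).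
(* The transfer from [p] to itself only weakens the bound [n - f] to more than [f]. *)
by rewrite (gba_return_support _ (support_transfer p lev)) lev.
Qed.

End Run.

Lemma gba_solves : solves_GBA f gba.
Proof.
split=> [input e p v hp /(gba_outputs _ hp) pv q hq|input e v inv p hp|
         input e p hp].
- have := support_transfer q (gba_return_grade1 pv).
  move=> /gba_return_support qv.
  by exists (n - f <= #|support (received e 1 q) v|); apply/gba_outputs.
- exact/gba_outputs/gba_return_valid.
- by exists (gba_return (input p) (received e 1 p)); apply/gba_outputs.
Qed.

Lemma gba_takes_two_rounds : takes_rounds gba f 2.
Proof.
move=> input e p hp [|[|t]]; first by rewrite gba_status0.
- by rewrite gba_status1.
- by rewrite gba_statusSS.
Qed.

End GradedAgreement.

Theorem mainTheorem2 (n f : nat) (V : Type) (hn : 1 <= n) (hf : 3 * f < n) :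
  exists A : algorithm n V (V * bool), solves_GBA f A /\ takes_rounds A f 2.
Proof.
(* Counting equal messages requires an equality test; [{classic V}] supplies a classical one for
   arbitrary [V]. *)
exists (gba n f {classic V}); split.
- exact: (@gba_solves n f {classic V} hf).
- exact: (@gba_takes_two_rounds n f {classic V}).
Qed.
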